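(* Let $X_1,\dots,X_n$, $\varepsilon$, $\gamma$ be as in the context, and let $L>0$ satisfy $L^3=L_{E,n}^3(\varepsilon,\gamma)$ or $L^3=L_{R,n}^3(\varepsilon,\gamma)$. Then: (i) for every $t\in\mathbb R$, $|\overline f_n(t)|\le\exp\{-k(L^3|t|,2\varepsilon|t|)\,t^2\}$; (ii) for every $L_0\ge L$, every $\tau\ge\underline\tau_1(L_0,\varepsilon):=\pi L_0^3/\varepsilon$ and every $|t|\le\tau/L^3$, $|\overline f_n(t)|\le\exp\{-k(\tau)t^2\}$; moreover $k(\tau)>0$ if and only if $\tau<\pi/4$, and the interval $[\underline\tau_1(L_0,\varepsilon),\pi/4)$ is nonempty if and only if $L_0<(\varepsilon/4)^{1/3}$; (iii) statements (i) and (ii) remain true when $L>0$ is defined instead by $L^3=\sup_{0<z\le\varepsilon}zL_n(z)$.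
   Context: Let $X_1,\dots,X_n$ be independent real random variables with $\mathbb E X_k=0$, $\sigma_k^2=\mathbb E X_k^2<\infty$, normalized so that $B_n^2=\sum_k\sigma_k^2=1$. Let $f_k(t)=\mathbb E e^{itX_k}$ and $\overline f_n(t)=\prod_{k=1}^nf_k(t)$. For $z\ge0$, $\sigma_k^2(z)=\mathbb E X_k^2\mathbf 1(|X_k|\ge z)$, $L_n(z)=\sum_k\sigma_k^2(z)$; for $z>0$, $M_n(z)=\sum_k\mathbb E X_k^3\mathbf 1(|X_k|<z)$. Fix $\gamma>0$. For $\varepsilon\in(0,\infty]$, $L_{E,n}^3(\varepsilon,\gamma)=\sup_{0<z\le\varepsilon}\{\gamma|M_n(z)|+zL_n(z)\}$; for $\varepsilon\in(0,\infty)$, $L_{R,n}^3(\varepsilon,\gamma)=\gamma|M_n(\varepsilon)|+\sup_{0<z\le\varepsilon}zL_n(z)$ ($\varepsilon$ ranges accordingly). Let $a(\theta)=2\frac{1-\cos\theta}{\theta^2}-\frac{\sin\theta}{2\theta}$, $b(\theta)=\frac{1-\cos\theta}{\theta^4}-\frac{\sin\theta}{2\theta^3}$ for $\theta\in(0,2\pi]$. For $\tau\ge0$, $u\ge0$, $\theta\in(0,2\pi]$ let $k(\tau,u,\theta)=a(\theta)-4\tau u^{-1}(a(\theta)+b(\theta)u^2)$ for $u>0$, $k(0,0,\theta)=a(\theta)$, $k(\tau,0,\theta)=-\infty$ for $\tau>0$; $k(\tau,u)=\sup_{0<\theta<2\pi}k\big(\tau,\min\{u,\sqrt{a(\theta)/b(\theta)}\},\theta\big)$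 (with $\min\{\infty,x\}=x$); and $k(\tau)=\sup_{0<\theta\le2\pi}\{a(\theta)-8\tau\sqrt{a(\theta)b(\theta)}\}$. *)

(* Defs.v *)
From HB Require Import structures.
From mathcomp Require Import all_boot all_order all_algebra.
From mathcomp Require Import all_classical all_reals all_analysis.
From mathcomp Require complex.
Import complex.ComplexField.
Set Implicit Arguments. Unset Strict Implicit. Unset Printing Implicit Defensive.
Import Order.TTheory GRing.Theory Num.Theory.
Local Open Scope classical_set_scope.
Local Open Scope ring_scope.

Section Defs.
Context {d : measure_display} {T : measurableType d} {R : realType}.
Variable P : probability T R.
Variable n : nat.
Variable X : 'I_n -> T -> R.

Definition mutually_independent : Prop :=
  forall (J : {set 'I_n}) (B : 'I_n -> set R),
    (forall i, measurable (B i)) ->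
    fine (P (\bigcap_(i in [set i | i \in J]) (X i @^-1` B i)))
    = \prod_(i in J) fine (P (X i @^-1` B i)).

Definition sigma2 (k : 'I_n) : R := fine (expectation P (fun w => X k w ^+ 2)).

Definition sigma2z (k : 'I_n) (z : R) : R :=
  fine (expectation P (fun w => X k w ^+ 2 * (z <= `|X k w|)%R%:R)).

Definition Ln (z : R) : R := \sum_(k < n) sigma2z k z.

Definition Mn (z : R) : R :=
  \sum_(k < n) fine (expectation P (fun w => X k w ^+ 3 * (`|X k w| < z)%R%:R)).

Definition charf (k : 'I_n) (t : R) : complex.complex R :=
  complex.Complex (fine (expectation P (fun w => cos (t * X k w))))
          (fine (expectation P (fun w => sin (t * X k w)))).

Definition fbar (t : R) : complex.complex R := \prod_(k < n) charf k t.

Definition LE3 (eps : \bar R) (gamma : R) : \bar R :=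
  ereal_sup [set ((gamma * `|Mn z| + z * Ln z)%:E) | z in [set z | 0 < z /\ (z%:E <= eps)%E]].

Definition LR3 (eps : R) (gamma : R) : \bar R :=
  ((gamma * `|Mn eps|)%:E +
   ereal_sup [set ((z * Ln z)%:E) | z in [set z : R | (0 < z <= eps)%R]])%E.

Definition Lsup3 (eps : \bar R) : \bar R :=
  ereal_sup [set ((z * Ln z)%:E) | z in [set z | 0 < z /\ (z%:E <= eps)%E]].

End Defs.

Section kfun.
Context {R : realType}.

Definition afun (th : R) : R := 2 * (1 - cos th) / th ^+ 2 - sin th / (2 * th).
Definition bfun (th : R) : R := (1 - cos th) / th ^+ 4 - sin th / (2 * th ^+ 3).

Definition k3 (tau u th : R) : \bar R :=
  if 0 < u then (afun th - 4 * tau / u * (afun th + bfun th * u ^+ 2))%:E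
  else if tau == 0 then (afun th)%:E else -oo%E.

Definition umin (u : \bar R) (th : R) : R :=
  match u with
  | r%:E => Num.min r (Num.sqrt (afun th / bfun th))
  | _ => Num.sqrt (afun th / bfun th)
  end.

Definition k2 (tau : R) (u : \bar R) : \bar R :=
  ereal_sup [set k3 tau (umin u th) th | th in [set th | 0 < th < 2 * pi]].

Definition k1 (tau : R) : \bar R :=
  ereal_sup [set ((afun th - 8 * tau * Num.sqrt (afun th * bfun th))%:E)
            | th in [set th | 0 < th <= 2 * pi]].

Definition tau1 (L0 : R) (eps : \bar R) : R :=
  match eps with
  | r%:E => pi * L0 ^+ 3 / r
  | _ => 0
  end.

(* cube root on \bar R (for nonnegative arguments), +oo^{1/3} = +oo *)
Definition ecbrt (x : \bar R) : \bar R :=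
  match x with
  | r%:E => (r `^ (3^-1))%:E
  | +oo%E => +oo%E
  | -oo%E => -oo%E
  end.

End kfun.

Definition conclusions {d : measure_display} {T : measurableType d} {R : realType}
  (P : probability T R) (n : nat) (X : 'I_n -> T -> R) (eps : \bar R) (L : R) : Prop :=
  (forall t : R,
     ((Normc.normc (fbar P X t))%:E
        <= expeR (- k2 (L ^+ 3 * `|t|) ((2 * `|t|)%:E * eps) * (t ^+ 2)%:E))%E)
  /\ (forall L0 : R, L <= L0 -> forall tau : R, tau1 L0 eps <= tau ->
        forall t : R, `|t| <= tau / L ^+ 3 ->
        ((Normc.normc (fbar P X t))%:E <= expeR (- k1 tau * (t ^+ 2)%:E))%E)
  /\ (forall tau : R, 0 <= tau -> ((0 < k1 tau)%E <-> tau < pi / 4))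
  /\ (forall L0 : R, L <= L0 ->
        ((exists tau : R, tau1 L0 eps <= tau < pi / 4)
         <-> (L0%:E < ecbrt (eps * (4^-1)%:E))%E)).

(* Main.v *)
Require Import Defs.
From HB Require Import structures.
From mathcomp Require Import all_boot all_order all_algebra.
From mathcomp Require Import all_classical all_reals all_analysis.
From mathcomp Require Import measurable_realfun ring lra.
From mathcomp Require complex.
Import complex.ComplexField.
Import Order.TTheory GRing.Theory Num.Theory.
Import numFieldNormedType.Exports.
Local Open Scope classical_set_scope.
Local Open Scope ring_scope.
Set Implicit Arguments. Unset Strict Implicit. Unset Printing Implicit Defensive.

(** Let [X'] be an independent copy of [X = X_k], so that
    [1 - |f_k(t)|^2 = E (1 - cos (t (X - X')))] and
    [|fbar(t)| <= exp (- 1/2 \sum_k (1 - |f_k(t)|^2))].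

    Since [(1 - cos z) / z^2] is convex as a function of [z^2] on [(0, 2 pi)], its
    tangent at [theta^2] gives [1 - cos z >= z^2 (a(theta) - b(theta) z^2)].  For
    [|z| < u <= sqrt (a/b)] the right-hand factor is approximated from below by
    step functions [\sum_j c_j 1(|z| < v_j)], with [\sum_j c_j] close to [a] and
    [\sum_j c_j / v_j] close to [(a + b u^2) / u].  A step at [v = 2 w |t|]
    contributes at least
    [E (X - X')^2 1(|X| < w) 1(|X'| < w) >= 2 (sigma_k^2 - 2 sigma_k^2(w))], by
    centering and Cauchy-Schwarz.  Summing over [k] and using [w L_n(w) <= L^3] for
    [w <= eps], which each choice of [L] guarantees, yields (i).

    For (ii), [a <= 4 pi^2 b] shows that replacing [u = 2 eps |t|] by
    [sqrt (a/b) <= 2 pi] costs nothing once [tau >= pi L^3 / eps].  As [a/b] tends to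
    its bound [4 pi^2] when [theta] tends to [2 pi], [a > 8 tau sqrt (a b)] holds for
    some [theta] exactly when [tau < pi/4]. *)

(** * The functions [a] and [b] *)

Section DeriveRules.
Context {R : realType}.
Implicit Types (f g : R -> R) (x : R).

(** The rules are stated for pointwise expressions, so that the tactic below can apply them by
    following the syntax. *)
Lemma is_derive_addf f g x (df dg : R) : is_derive x 1 f df ->
  is_derive x 1 g dg -> is_derive x 1 (fun y => f y + g y) (df + dg).
Proof. exact: is_deriveD. Qed.

Lemma is_derive_oppf f x (df : R) : is_derive x 1 f df ->
  is_derive x 1 (fun y => - f y) (- df).
Proof. exact: is_deriveN. Qed.

Lemma is_derive_mulf f g x (df dg : R) : is_derive x 1 f df ->
  is_derive x 1 g dg -> is_derive x 1 (fun y => f y * g y) (f x * dg + g x * df).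
Proof. exact: is_deriveM. Qed.

Lemma is_derive_expf f n x (df : R) : is_derive x 1 f df ->
  is_derive x 1 (fun y => f y ^+ n) (n%:R * f x ^+ n.-1 * df).
Proof.
move=> fdf; have -> : (fun y => f y ^+ n) = f ^+ n by rewrite exprfctE.
exact: is_deriveX.
Qed.

Lemma is_derive_invf f x (df : R) : f x != 0 -> is_derive x 1 f df ->
  is_derive x 1 (fun y => (f y)^-1) (- (f x) ^- 2 * df).
Proof. exact: is_deriveV. Qed.

Lemma is_derive_eqf f x (df df' : R) : is_derive x 1 f df' -> df' = df ->
  is_derive x 1 f df.
Proof. by move=> ? <-. Qed.

End DeriveRules.

Ltac derive_rules := repeat first
  [ notypeclasses refine (is_derive_cst _ _ _)
  | notypeclasses refine (is_derive_id _ _)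
  | notypeclasses refine (is_derive_sin _) | notypeclasses refine (is_derive_cos _)
  | notypeclasses refine (is_derive_addf _ _)
  | notypeclasses refine (is_derive_oppf _)
  | notypeclasses refine (is_derive_expf _ _)
  | notypeclasses refine (is_derive_invf _ _)
  | notypeclasses refine (is_derive_mulf _ _) ].

(** The rules build a derivative in their own form; the second goal identifies it with the claimed
    one. *)
Ltac derive_tac := notypeclasses refine (is_derive_eqf _ _); [derive_rules | rewrite /cst /=].

(** * Sign arguments by repeated differentiation, and the tangent bound for the cosine *)

Section Trigonometry.
Context {R : realType}.
Implicit Types (f g : R -> R) (x y z th : R).

Lemma derive_MVT f (df : R -> R) a b : a < b ->
  (forall x, a <= x <= b -> is_derive x 1 f (df x)) ->
  exists2 c, a < c < b & f b - f a = df c * (b - a).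
Proof.
move=> ab fdf.
have [x xab|x|c] := @MVT R f df a b ab; last by rewrite in_itv/=; exists c.
- by apply: fdf; move: xab; rewrite in_itv/= => /andP[/ltW-> /ltW->].
- apply: derivable_within_continuous => {}x; rewrite in_itv/= => xab.
  by case: (fdf _ xab).
Qed.

Lemma derive_le f (df : R -> R) a b : a <= b ->
  (forall x, a <= x <= b -> is_derive x 1 f (df x)) ->
  (forall x, a < x < b -> 0 <= df x) -> f a <= f b.
Proof.
rewrite le_eqVlt => /predU1P[->//|ab] fdf df0.
have [c cab e] := derive_MVT ab fdf.
by rewrite -subr_ge0 e mulr_ge0 ?df0// subr_ge0 ltW.
Qed.

(** At most one change of sign, from plus to minus. The property passes from a derivative to a
    primitive that starts nonnegative, so it can be checked after several differentiations. *)
Definition single_crossing g b := forall x y, 0 < x -> x < y -> y < b ->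
  g x < 0 -> g y <= 0.

(** Since [f x < 0 <= f 0], the mean value theorem gives a point before [x] where [df] is negative.
    From [x] on, [df] is then nonpositive and [f] cannot increase. *)
Lemma derive_single_crossing f (df : R -> R) b : 0 <= f 0 ->
  (forall x, 0 <= x <= b -> is_derive x 1 f (df x)) ->
  single_crossing df b ->
  forall x y, 0 < x -> x < y -> y <= b -> f x < 0 -> f y <= f x.
Proof.
move=> f0 fdf sc x y x0 xy yb fx.
have [||c /andP[c0 cx] e] := @derive_MVT f df 0 x => //.
  by move=> z /andP[z0 zx]; apply: fdf; rewrite z0 (le_trans zx)// (le_trans (ltW xy)).
have dc : df c < 0.
  by rewrite -(pmulr_llt0 _ x0); move: e; rewrite subr0 => <-; lra.
rewrite -lerN2; apply: (@derive_le (fun z => - f z) (fun z => - df z)).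
- exact: ltW.
- move=> z /andP[xz zy]; apply: is_derive_oppf; apply: fdf.
  by rewrite (le_trans (ltW x0) xz) (le_trans zy).
- move=> z /andP[xz zy]; rewrite oppr_ge0; apply: (sc c) => //; lra.
Qed.

Lemma single_crossingP f (df : R -> R) b : 0 <= f 0 ->
  (forall x, 0 <= x <= b -> is_derive x 1 f (df x)) ->
  single_crossing df b -> single_crossing f b.
Proof.
move=> f0 fdf sc x y x0 xy yb fx; apply: (@le_trans _ _ (f x)); last exact: ltW.
exact: derive_single_crossing fdf sc _ _ x0 xy (ltW yb) fx.
Qed.

(** A negative value would persist up to [b], against [0 <= f b]. *)
Lemma single_crossing_ge0 f (df : R -> R) b : 0 <= f 0 -> 0 <= f b ->
  (forall x, 0 <= x <= b -> is_derive x 1 f (df x)) ->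
  single_crossing df b -> forall x, 0 < x < b -> 0 <= f x.
Proof.
move=> f0 fb fdf sc x /andP[x0 xb]; rewrite leNgt; apply/negP => fx.
have := derive_single_crossing f0 fdf sc x0 xb (lexx _) fx; lra.
Qed.

Lemma mulr_pi2 : 2 * pi = pi *+ 2 :> R. Proof. by rewrite mulr_natl. Qed.

Lemma sin_le0_pi2 x : pi <= x <= 2 * pi -> sin x <= 0.
Proof.
move=> xpi; have -> : x = (x - pi) + pi by ring.
by rewrite sinDpi oppr_le0 sin_ge0_pi//; lra.
Qed.

Lemma xcos_lt_sin x : 0 < x < pi -> x * cos x < sin x.
Proof.
move=> /andP[x0 xpi].
have [||c /andP[c0 cx]] := @derive_MVT (fun z => sin z - z * cos z)
  (fun z => z * sin z) 0 x => //.
  by move=> z _; derive_tac; ring.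
rewrite sin0 mul0r !subr0 => e.
rewrite -subr_gt0 e !mulr_gt0// sin_gt0_pi// c0/=; lra.
Qed.

(* This is [- 2 * th ^+ 5] times the derivative of [bfun] at [th]. *)
Lemma bfun_bracket_ge0 th : 0 < th < 2 * pi ->
  0 <= 8 * (1 - cos th) + th ^+ 2 * cos th - 5 * th * sin th.
Proof.
have pi0 : 0 < (pi : R) := pi_gt0 R.
(* Three differentiations, dropping a positive factor [z] before the last one, lead to [z * sin z],
   whose only change of sign is at [pi]. The endpoint value at [2 * pi] is [4 pi^2]. *)
apply: (@single_crossing_ge0
  (fun z => 8 * (1 - cos z) + z ^+ 2 * cos z - 5 * z * sin z)
  (fun z => 3 * sin z - 3 * z * cos z - z ^+ 2 * sin z)).
- by rewrite cos0 sin0; lra.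
- rewrite mulr_pi2 cos2pi sin2pi; nra.
- by move=> z _; derive_tac; ring.
apply: (@single_crossingP _ (fun z => z * (sin z - z * cos z))).
- by rewrite cos0 sin0; lra.
- by move=> z _; derive_tac; ring.
have sc : single_crossing (fun z : R => sin z - z * cos z) (2 * pi).
  apply: (@single_crossingP _ (fun z => z * sin z)).
  - by rewrite cos0 sin0; lra.
  - by move=> z _; derive_tac; ring.
  move=> x y x0 xy yb sx; rewrite pmulr_rle0; last lra.
  apply: sin_le0_pi2; apply/andP; split; last exact: ltW.
  rewrite (le_trans _ (ltW xy))// leNgt; apply/negP => xpi.
  by have := mulr_gt0 x0 (@sin_gt0_pi R x _); rewrite x0 xpi => /(_ erefl); lra.
move=> x y x0 xy yb; rewrite pmulr_rlt0// => sx; rewrite pmulr_rle0; last lra.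
exact: sc sx.
Qed.

Lemma bfun_nincr x y : 0 < x -> x <= y -> y < 2 * pi -> bfun y <= bfun x.
Proof.
move=> x0 xy ypi; rewrite -lerN2.
apply: (@derive_le (fun z => - bfun z)
  (fun z => (8 * (1 - cos z) + z ^+ 2 * cos z - 5 * z * sin z) / (2 * z ^+ 5))); first exact: xy.
  move=> z /andP[xz zy]; have z0 : z != 0 by apply: lt0r_neq0; lra.
  rewrite /bfun; derive_tac.
  - by rewrite expf_neq0.
  - by rewrite mulf_neq0 ?expf_neq0// pnatr_eq0.
  - by field.
move=> z /andP[xz zy]; rewrite divr_ge0//.
  by apply: bfun_bracket_ge0; lra.
by rewrite mulr_ge0// exprn_ge0//; lra.
Qed.

Lemma tangent_eq th : th != 0 -> 1 - cos th = afun th * th ^+ 2 - bfun th * th ^+ 4.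
Proof. by move=> th0; rewrite /afun /bfun; field. Qed.

(* [(1 - cos z) / z ^+ 2] is a convex function of [z ^+ 2], as its slope is
   [- bfun z]; the right-hand side is its tangent at [th ^+ 2]. *)
Lemma cos_tangent th z : 0 < th < 2 * pi -> 0 <= z < 2 * pi ->
  z ^+ 2 * (afun th - bfun th * z ^+ 2) <= 1 - cos z.
Proof.
move=> /andP[th0 thpi] /andP[]; rewrite le_eqVlt => /predU1P[<-|z0] zpi.
  by rewrite cos0 expr0n/= mul0r subrr.
(* As [bfun] is nonincreasing, the derivative below shows that [r] decreases up to [th] and
   increases afterwards; its minimum is [r th = afun th]. *)
pose r z : R := (1 - cos z) / z ^+ 2 + bfun th * z ^+ 2.
have dr (x : R) : 0 < x -> is_derive x 1 r (2 * x * (bfun th - bfun x)).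
  move=> /lt0r_neq0 x0; rewrite /r; derive_tac.
    by rewrite expf_neq0.
  by rewrite [bfun x]/bfun; field.
have rth : r th = afun th.
  by rewrite /r tangent_eq ?lt0r_neq0//; field; rewrite lt0r_neq0.
suff : afun th <= r z.
  rewrite -lerBlDr ler_pdivlMr ?exprn_gt0//; first by rewrite mulrC.
rewrite -rth; have [zth|thz] := leP z th.
  rewrite -lerN2; apply: (@derive_le (fun z => - r z)
    (fun x => - (2 * x * (bfun th - bfun x)))); first exact: zth.
    by move=> x xth; apply: is_derive_oppf; apply: dr; lra.
  move=> x /andP[zx xth]; have := @bfun_nincr x th ltac:(lra) ltac:(lra) thpi; nra.
apply: (@derive_le r (fun x => 2 * x * (bfun th - bfun x))); first exact: ltW.
  by move=> x xth; apply: dr; lra.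
move=> x /andP[thx xz]; have := @bfun_nincr th x ltac:(lra) ltac:(lra) ltac:(lra); nra.
Qed.

Lemma cos_half th : cos th = cos (th / 2) ^+ 2 - sin (th / 2) ^+ 2.
Proof. by rewrite [in LHS](splitr th) cosD -!expr2. Qed.

Lemma sin_half th : sin th = 2 * sin (th / 2) * cos (th / 2).
Proof. by rewrite [in LHS](splitr th) sinD; ring. Qed.

(** In the half angle both functions factor, so that their signs on [(0, 2 pi)] follow from
    [0 < sin x] and [x * cos x < sin x] on [(0, pi)]. *)
Lemma afun_half x : x != 0 ->
  afun (2 * x) = sin x / (2 * x ^+ 2) * (2 * sin x - x * cos x).
Proof.
move=> x0; rewrite /afun (cos_half (2 * x)) (sin_half (2 * x)).
have -> : 2 * x / 2 = x by field.
by rewrite cos2sin2; field.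
Qed.

Lemma bfun_half x : x != 0 ->
  bfun (2 * x) = sin x / (8 * x ^+ 4) * (sin x - x * cos x).
Proof.
move=> x0; rewrite /bfun (cos_half (2 * x)) (sin_half (2 * x)).
have -> : 2 * x / 2 = x by field.
by rewrite cos2sin2; field.
Qed.

Lemma afun_gt0 th : 0 < th < 2 * pi -> 0 < afun th.
Proof.
move=> thpi; have -> : th = 2 * (th / 2) by field.
have hpi : 0 < th / 2 < pi by lra.
rewrite afun_half; last by apply: lt0r_neq0; lra.
have := xcos_lt_sin hpi; have := sin_gt0_pi hpi => s0 c0.
by rewrite mulr_gt0 ?divr_gt0 ?mulr_gt0 ?exprn_gt0//; lra.
Qed.

Lemma bfun_gt0 th : 0 < th < 2 * pi -> 0 < bfun th.
Proof.
move=> thpi; have -> : th = 2 * (th / 2) by field.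
have hpi : 0 < th / 2 < pi by lra.
rewrite bfun_half; last by apply: lt0r_neq0; lra.
have := xcos_lt_sin hpi; have := sin_gt0_pi hpi => s0 c0.
by rewrite mulr_gt0 ?divr_gt0 ?mulr_gt0 ?exprn_gt0//; lra.
Qed.

Lemma afun2pi : afun (2 * pi) = 0 :> R.
Proof. by rewrite /afun mulr_pi2 cos2pi sin2pi subrr !(mulr0, mul0r) subrr. Qed.

Lemma bfun2pi : bfun (2 * pi) = 0 :> R.
Proof. by rewrite /bfun mulr_pi2 cos2pi sin2pi subrr !(mulr0, mul0r) subrr. Qed.

End Trigonometry.

(** * Comparison of [afun] with [bfun], and the sign of [k1] *)

Section AfunBfun.
Context {R : realType}.
Implicit Types (f g : R -> R) (x y z th : R).

Lemma sin_le_id x : 0 <= x -> sin x <= x.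
Proof.
move=> x0; rewrite -subr_ge0.
suff : 0 - sin 0 <= x - sin x by rewrite sin0 subrr.
apply: (@derive_le _ (fun z => z - sin z) (fun z => 1 - cos z)); first exact: x0.
by move=> z _; rewrite subr_ge0 cos_le1.
Qed.

Lemma cos_nincr x y : 0 <= x -> x <= y -> y <= pi -> cos y <= cos x.
Proof.
move=> x0 xy ypi; rewrite leNgt ltr_cos -?leNgt// in_itv/=; apply/andP; split; lra.
Qed.

(** Otherwise [cos (6 / 5) <= 0], whereas [1 - 2 sin^2 (3 / 5) >= 1 - 18 / 25]. The constant is
    large enough for [3 pi^2 / 4 >= 4], which the next lemma needs on [(0, pi / 2]]. *)
Lemma pi_gt12_5 : 12 / 5 < pi :> R.
Proof.
rewrite ltNge; apply/negP => pile; have pi2 := @pi_ge2 R.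
have : cos (6 / 5) <= cos (pi / 2) :> R by apply: cos_nincr; lra.
rewrite cos_pihalf cos_half cos2sin2.
have s0 : 0 <= sin (6 / 5 / 2) :> R by apply: sin_ge0_pi; apply/andP; split; lra.
have : sin (6 / 5 / 2) <= 6 / 5 / 2 :> R by apply: sin_le_id; lra.
nra.
Qed.

(** With [x = th / 2], the difference of the two sides is a nonnegative multiple of a function that
    vanishes at [0] and at [pi] and has derivative [x * h x]. It remains to see that [h] changes
    sign at most once. *)
Lemma afun_le_bfun th : 0 < th <= 2 * pi -> afun th <= 4 * pi ^+ 2 * bfun th.
Proof.
move=> /andP[th0]; rewrite le_eqVlt => /predU1P[->|thpi].
  by rewrite afun2pi bfun2pi mulr0.
pose h (x : R) : R := x * cos x + (pi ^+ 2 - 4 - x ^+ 2) * sin x.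
have pi0 := pi_gt12_5.
have h0 x : 0 < x <= pi / 2 -> 0 <= h x.
  move=> /andP[x0 xpi].
  have c0 : 0 <= cos x by apply: cos_ge0_pihalf; apply/andP; split; lra.
  have s0 : 0 <= sin x by apply: sin_ge0_pi; apply/andP; split; lra.
  have e : 0 <= pi ^+ 2 - 4 - x ^+ 2 by nra.
  by rewrite addr_ge0// mulr_ge0// ltW.
have hsc : single_crossing h pi.
  move=> x y x0 xy ypi hx.
  have xpi2 : pi / 2 < x.
    by rewrite ltNge; apply/negP => /(conj x0)/andP/h0; rewrite leNgt hx.
  have cxy : cos y <= cos x.
    by apply: cos_nincr; lra.
  have cx0 : cos x <= 0.
    by rewrite -cos_pihalf; apply: cos_nincr; lra.
  have s0 : 0 <= sin y by apply: sin_ge0_pi; apply/andP; split; lra.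
  have sxy : sin y <= sin x.
    by rewrite -!cosBpihalf; apply: cos_nincr; lra.
  rewrite /h in hx *.
  (* If the polynomial factor is nonpositive at [y], both terms of [h y] are. Otherwise both terms
     are smaller at [y] than at [x], because sine and cosine decrease on [[pi / 2, pi]]. *)
  have [e|e] := leP (pi ^+ 2 - 4 - y ^+ 2) 0.
    have := @mulr_le0_ge0 _ _ (sin y) e s0.
    have := @mulr_ge0_le0 _ y (cos y) ltac:(lra) ltac:(lra); lra.
  have : (pi ^+ 2 - 4 - y ^+ 2) * sin y <= (pi ^+ 2 - 4 - x ^+ 2) * sin x.
    by apply: ler_pM => //; nra.
  nra.
have g0 : 0 <= (pi ^+ 2 - 2 * (th / 2) ^+ 2) * sin (th / 2)
               - (th / 2) * (pi ^+ 2 - (th / 2) ^+ 2) * cos (th / 2).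
  apply: (@single_crossing_ge0 _ (fun x => (pi ^+ 2 - 2 * x ^+ 2) * sin x
               - x * (pi ^+ 2 - x ^+ 2) * cos x) (fun x => x * h x) pi).
  - by rewrite sin0; lra.
  - by rewrite sinpi cospi; lra.
  - by move=> x _; derive_tac; rewrite /h; ring.
  - move=> x y x0 xy ypi; rewrite pmulr_rlt0// pmulr_rle0; last lra.
    exact: hsc.
  - by lra.
have -> : th = 2 * (th / 2) by field.
have x0 : 0 < th / 2 by lra.
rewrite afun_half ?bfun_half ?lt0r_neq0// -subr_ge0.
have xpi : th / 2 <= pi by lra.
set x := th / 2 in x0 xpi g0 *.
have -> : 4 * pi ^+ 2 * (sin x / (8 * x ^+ 4) * (sin x - x * cos x))
    - sin x / (2 * x ^+ 2) * (2 * sin x - x * cos x)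
  = sin x / (2 * x ^+ 4) * ((pi ^+ 2 - 2 * x ^+ 2) * sin x
               - x * (pi ^+ 2 - x ^+ 2) * cos x).
  by field; rewrite lt0r_neq0.
rewrite mulr_ge0// divr_ge0//; first by apply: sin_ge0_pi; apply/andP; split; lra.
by rewrite mulr_ge0// exprn_ge0// ltW.
Qed.

(** Points below this threshold thus lie in the range where [cos_tangent] applies. *)
Lemma sqrt_afun_div_bfun_le th : 0 < th < 2 * pi ->
  Num.sqrt (afun th / bfun th) <= 2 * pi.
Proof.
move=> thpi; have b0 := bfun_gt0 thpi; have pi0 := pi_gt0 R.
rewrite -(@ger0_norm _ (2 * pi)) ?mulr_ge0 ?(ltW pi0)// -sqrtr_sqr ler_wsqrtr//.
rewrite ler_pdivrMr// (le_trans (afun_le_bfun _))//; first by lra.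
by rewrite le_eqVlt; apply/orP; left; apply/eqP; ring.
Qed.

Lemma k1_gt0P (tau : R) : 0 <= tau -> (0 < k1 tau)%E <-> tau < pi / 4.
Proof.
move=> tau0; have pi0 := pi_gt0 R; split.
  move=> /ereal_sup_gt[_ [th /= thpi <-]]; rewrite lte_fin subr_gt0.
  move: (thpi) => /andP[th0]; rewrite le_eqVlt => /predU1P[->|thlt].
    by rewrite afun2pi mul0r sqrtr0 mulr0 ltxx.
  have a0 := @afun_gt0 R th ltac:(lra); have b0 := @bfun_gt0 R th ltac:(lra).
  have le4 := afun_le_bfun thpi.
  rewrite sqrtrM ?(ltW a0)// -[X in _ < X](sqr_sqrtr (ltW a0)) expr2 !mulrA mulrAC ltr_pM2r ?sqrtr_gt0// => lt.
  rewrite ltNge; apply/negP => taupi.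
  suff : Num.sqrt (afun th) <= 2 * pi * Num.sqrt (bfun th).
    have : 0 < Num.sqrt (bfun th) by rewrite sqrtr_gt0.
    by move=> sb0 sab; have := ler_wpM2r (ltW sb0) taupi; lra.
  rewrite -[2 * pi]ger0_norm ?mulr_ge0 ?(ltW pi0)// -sqrtr_sqr -sqrtrM ?sqr_ge0//.
  by rewrite ler_wsqrtr//; lra.
move=> taupi.
(* Up to the factor [sin x / (2 x^4)], this is [afun (2 x) - (8 tau)^2 bfun (2 x)]. That factor
   vanishes at [pi], but [f pi = pi (pi^2 - 16 tau^2)] is positive, so by continuity [f] is positive
   at some [x < pi]. *)
pose f (x : R) : R := x ^+ 2 * (2 * sin x - x * cos x) - 16 * tau ^+ 2 * (sin x - x * cos x).
have fpi : 0 < f pi.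
  rewrite /f sinpi cospi.
  have -> : pi ^+ 2 * (2 * 0 - pi * -1) - 16 * tau ^+ 2 * (0 - pi * -1)
    = pi * ((pi - 4 * tau) * (pi + 4 * tau)) :> R by ring.
  by rewrite !mulr_gt0//; lra.
have [df fd] : exists df, forall x, is_derive x 1 f (df x).
  eexists => x; rewrite /f; derive_rules.
have cf : {for pi, continuous f}.
  by apply/differentiable_continuous/derivable1_diffP; case: (fd pi).
have [x [x0 xpi fx]] : exists x, [/\ 0 < x, x < pi & 0 < f x].
  near (@pi R)^'- => x; exists x; split.
  - by near: x; exact: nbhs_left_gt.
  - by near: x; exact: nbhs_left_lt.
  - by near: x; apply: (cvgr_gt (f pi)) => //; apply: cvg_at_left_filter.
have thpi : 0 < 2 * x < 2 * pi by lra.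
have a0 := afun_gt0 thpi; have b0 := bfun_gt0 thpi.
apply: lt_le_trans (ereal_sup_ubound _); last first.
  by exists (2 * x) => //=; lra.
rewrite lte_fin subr_gt0 sqrtrM ?(ltW a0)// -[X in _ < X](sqr_sqrtr (ltW a0)) expr2 !mulrA mulrAC.
rewrite ltr_pM2r ?sqrtr_gt0// -[8 * tau]ger0_norm ?mulr_ge0// -sqrtr_sqr -sqrtrM ?sqr_ge0//.
rewrite ltr_sqrt// -subr_gt0.
have -> : afun (2 * x) - (8 * tau) ^+ 2 * bfun (2 * x) = sin x / (2 * x ^+ 4) * f x.
  by rewrite afun_half ?bfun_half ?lt0r_neq0// /f; field; rewrite lt0r_neq0.
by rewrite mulr_gt0// divr_gt0 ?mulr_gt0 ?exprn_gt0// sin_gt0_pi// x0.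
Unshelve. all: by end_near. Qed.

End AfunBfun.

(** * Nonemptiness of the range of [tau] *)

Section Threshold.
Context {R : realType}.

Lemma tau1_nonempty (L0 : R) (eps : \bar R) : 0 < L0 -> (0 < eps)%E ->
  (exists tau : R, tau1 L0 eps <= tau < pi / 4)
  <-> (L0%:E < ecbrt (eps * (4^-1)%:E))%E.
Proof.
move=> L0pos; have pi0 := pi_gt0 R.
case: eps => [r| |]//; rewrite ?lte_fin => r0; last first.
  (* For [eps = +oo] both sides hold: [tau1] is [0] and the cube root is [+oo]. *)
  rewrite gt0_mulye ?lte_fin ?invr_gt0// /= ltry; split=> // _.
  by exists 0; rewrite lexx divr_gt0.
have cube : ((r / 4) `^ (3^-1)) ^+ 3 = r / 4.
  rewrite -powR_mulrn ?powR_ge0// -powRrM mulVf ?pnatr_eq0// powRr1//.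
  by rewrite divr_ge0// ltW.
have key : (pi * L0 ^+ 3 / r < pi / 4) = (L0 < (r / 4) `^ (3^-1)).
  rewrite -[RHS](@ltr_pXn2r _ 3)// ?nnegrE ?powR_ge0 ?(ltW L0pos)// cube.
  rewrite ltr_pdivrMr// mulrAC -mulrA ltr_pM2l//.
rewrite -key; split=> [[tau /andP[]]|lt]; first exact: le_lt_trans.
by exists (pi * L0 ^+ 3 / r); rewrite lexx.
Qed.
End Threshold.

(** * Iterated means and truncated moments *)

Section Mean.
Context {d : measure_display} {T : measurableType d} {R : realType}.
Variable P : probability T R.
Implicit Types (f g : T -> R) (F G : T -> T -> R).

Definition mean f : R := fine (expectation P f).

Notation intg f := (P.-integrable setT (EFin \o (f : T -> R))).

Lemma meanE f : mean f = Rintegral P setT f.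
Proof. by rewrite /mean unlock. Qed.

Lemma intg_cst (a : R) : intg (fun=> a).
Proof.
exact: (@finite_measure_integrable_cst _ _ _ P).
Qed.

Lemma intgD f g : intg f -> intg g -> intg (fun w => f w + g w).
Proof. by move=> fi gi; exact: (integrableD measurableT fi gi). Qed.

Lemma intgZ (a : R) f : intg f -> intg (fun w => a * f w).
Proof. by move=> fi; exact: (integrableZl measurableT a fi). Qed.

Lemma intg_le f g : measurable_fun setT f -> (forall w, `|f w| <= `|g w|) ->
  intg g -> intg f.
Proof.
move=> mf fg; apply: le_integrable => //; first exact/measurable_EFinP.
by move=> w _; rewrite /= lee_fin.
Qed.

Lemma meanD f g : intg f -> intg g ->
  mean (fun w => f w + g w) = mean f + mean g.
Proof. by move=> fi gi; rewrite !meanE RintegralD. Qed.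

Lemma meanZ (a : R) f : intg f -> mean (fun w => a * f w) = a * mean f.
Proof. by move=> fi; rewrite !meanE RintegralZl. Qed.

Lemma mean_cst (a : R) : mean (fun=> a) = a.
Proof. by rewrite /mean expectation_cst. Qed.

Lemma mean_ge0 f : (forall w, 0 <= f w) -> 0 <= mean f.
Proof. by move=> f0; rewrite meanE Rintegral_ge0. Qed.

Lemma mean_le f g : intg f -> intg g -> (forall w, f w <= g w) -> mean f <= mean g.
Proof. by move=> fi gi fg; rewrite !meanE le_Rintegral. Qed.

(* For kernels that are finite sums of products, integrating one variable after
   the other replaces integrals over the product space [T * T]. *)
Definition iterated_mean F (e : R) := [/\ forall y, intg (F ^~ y),
  intg (fun y => mean (F ^~ y)) & mean (fun y => mean (F ^~ y)) = e].

Lemma iterated_mean_ge0 F e : (forall x y, 0 <= F x y) -> iterated_mean F e -> 0 <= e.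
Proof. by move=> F0 [_ _ <-]; do 2 (apply: mean_ge0 => ?). Qed.

Lemma iterated_mean_prod f g : intg f -> intg g ->
  iterated_mean (fun x y => f x * g y) (mean f * mean g).
Proof.
move=> fi gi.
have e y : mean (fun x => f x * g y) = mean f * g y.
  by under eq_fun do rewrite mulrC; rewrite meanZ// mulrC.
split=> [y||].
- by under eq_fun do rewrite mulrC; exact: intgZ.
- by under eq_fun do rewrite e; exact: intgZ.
- by under eq_fun do rewrite e; rewrite meanZ.
Qed.

Lemma iterated_meanD F G e e' : iterated_mean F e -> iterated_mean G e' ->
  iterated_mean (fun x y => F x y + G x y) (e + e').
Proof.
move=> [Fi Fi2 Fe] [Gi Gi2 Ge].
have m y : mean (fun x => F x y + G x y) = mean (F ^~ y) + mean (G ^~ y) by rewrite meanD.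
split=> [y||].
- exact: intgD.
- by under eq_fun do rewrite m; exact: intgD.
- by under eq_fun do rewrite m; rewrite meanD// Fe Ge.
Qed.

Lemma iterated_meanZ (a : R) F e : iterated_mean F e ->
  iterated_mean (fun x y => a * F x y) (a * e).
Proof.
move=> [Fi Fi2 Fe].
have m y : mean (fun x => a * F x y) = a * mean (F ^~ y) by rewrite meanZ.
split=> [y||].
- exact: intgZ.
- by under eq_fun do rewrite m; exact: intgZ.
- by under eq_fun do rewrite m; rewrite meanZ// Fe.
Qed.

Lemma iterated_mean_sum N (F : nat -> T -> T -> R) (e : nat -> R) :
  (forall j, (j < N)%N -> iterated_mean (F j) (e j)) ->
  iterated_mean (fun x y => \sum_(j < N) F j x y) (\sum_(j < N) e j).
Proof.
elim: N => [|N IH] Fe.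
  under eq_fun do under eq_fun do rewrite big_ord0.
  rewrite big_ord0 -[X in iterated_mean _ X](mulr0 (mean (fun=> 0))) -[X in _ * X]mean_cst.
  have := iterated_mean_prod (intg_cst 0) (intg_cst 0).
  by under eq_fun do under eq_fun do rewrite mulr0.
under eq_fun do under eq_fun do rewrite big_ord_recr.
rewrite big_ord_recr; apply: iterated_meanD; last exact: Fe.
by apply: IH => j jN; apply: Fe; exact: ltnW.
Qed.

End Mean.

Notation intg P f := (P.-integrable setT (EFin \o f)).

(** * Truncation and symmetrization of a single variable *)

Section OneVariable.
Context {d : measure_display} {T : measurableType d} {R : realType}.
Variables (P : probability T R) (X : {RV P >-> R}).
Hypothesis X1 : intg P X.
Hypothesis X2 : intg P (fun w => X w ^+ 2).
Hypothesis EX0 : mean P X = 0.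

Let mX : measurable_fun setT X. Proof. exact: measurable_funPT. Qed.

Let near0 (z : R) w : R := (`|X w| < z)%R%:R.
Let far0 (z : R) w : R := (z <= `|X w|)%R%:R.

Let q z := mean P (near0 z).
Let m z := mean P (fun w => X w * near0 z w).
Let v z := mean P (fun w => X w ^+ 2 * near0 z w).
Let rho z := mean P (fun w => X w ^+ 2 * far0 z w).

Lemma measurable_boolr (b : T -> bool) : measurable_fun setT b ->
  measurable_fun setT (fun w => (b w)%:R : R).
Proof.
move=> mb; exact: (@measurableT_comp _ _ _ _ _ _ (fun b : bool => b%:R : R)).
Qed.

Let far0E z w : far0 z w = 1 - near0 z w.
Proof. by rewrite /far0 /near0 leNgt; case: ltP; rewrite ?subrr ?subr0. Qed.

Let near0_bounds z w : 0 <= near0 z w <= 1.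
Proof. by rewrite /near0; case: ltP; rewrite ?ler01 ?lexx. Qed.

Let mnear0 z : measurable_fun setT (near0 z).
Proof.
apply: measurable_boolr; apply: measurable_fun_ltr => //.
exact: measurableT_comp.
Qed.

Let inear0 z : intg P (near0 z).
Proof.
apply: (intg_le _ _ (intg_cst P 1)) => // w.
by have /andP[? ?] := near0_bounds z w; rewrite normr1 ger0_norm.
Qed.

Let iXnear0 z : intg P (fun w => X w * near0 z w).
Proof.
apply: (intg_le _ _ X1) => [|w]; first exact: measurable_funM.
by have /andP[? ?] := near0_bounds z w; rewrite normrM ler_piMr// ger0_norm.
Qed.

Let iX2near0 z : intg P (fun w => X w ^+ 2 * near0 z w).
Proof.
apply: (intg_le _ _ X2) => [|w].
  by apply: measurable_funM => //; exact: measurable_funX.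
by have /andP[? ?] := near0_bounds z w; rewrite normrM ler_piMr// ger0_norm.
Qed.

Let iX2far0 z : intg P (fun w => X w ^+ 2 * far0 z w).
Proof.
have -> : (fun w => X w ^+ 2 * far0 z w)
    = (fun w => X w ^+ 2 + -1 * (X w ^+ 2 * near0 z w)).
  by apply/funext => w; rewrite far0E; ring.
by apply: intgD => //; exact: intgZ.
Qed.

Let v_rho z : mean P (fun w => X w ^+ 2) = v z + rho z.
Proof. by rewrite -meanD//; congr mean; apply/funext => w; rewrite far0E; ring. Qed.

(* The quadratic in [l] is the mean of [(l + X)^2] over [z <= |X|], where
   [X] integrates to [- m z]. *)
Let far_quadratic z l : 0 <= rho z - 2 * l * m z + l ^+ 2 * (1 - q z).
Proof.
have : 0 <= mean P (fun w => (l + X w) ^+ 2 * far0 z w).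
  by apply: mean_ge0 => w; rewrite mulr_ge0 ?sqr_ge0 ?ler0n.
have -> : (fun w => (l + X w) ^+ 2 * far0 z w) =
    (fun w => (X w ^+ 2 * far0 z w + (2 * l) * X w)
      + ((- (2 * l)) * (X w * near0 z w) + (l ^+ 2 + (- l ^+ 2) * near0 z w))).
  by apply/funext => w; rewrite far0E; ring.
have iX := intgZ (2 * l) X1.
have iXn := intgZ (- (2 * l)) (iXnear0 z).
have in0 := intgZ (- l ^+ 2) (inear0 z).
have ic := intgD (intg_cst P (l ^+ 2)) in0.
rewrite (meanD (intgD (iX2far0 z) iX) (intgD iXn ic)) (meanD (iX2far0 z) iX).
rewrite (meanD iXn ic) (meanD (intg_cst P (l ^+ 2)) in0).
rewrite (meanZ (2 * l) X1) (meanZ (- (2 * l)) (iXnear0 z)) (meanZ (- l ^+ 2) (inear0 z)).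
rewrite mean_cst EX0 -/(rho z) -/(m z) -/(q z); lra.
Qed.

Let q_bounds z : 0 <= q z <= 1.
Proof.
apply/andP; split.
  by apply: mean_ge0 => w; case/andP: (near0_bounds z w).
rewrite -[leRHS](mean_cst P); apply: mean_le => //; first exact: intg_cst.
by move=> w; case/andP: (near0_bounds z w).
Qed.

(** Cauchy-Schwarz, from the quadratic at its minimum [l = m z / (1 - q z)]. When [1 - q z = 0] the
    expression is affine in [l], and its nonnegativity for all [l] forces [m z = 0]. *)
Let m_sqr_le z : m z ^+ 2 <= (1 - q z) * rho z.
Proof.
have /andP[_ q1] := q_bounds z.
have [p0|p0] := eqVneq (1 - q z) 0.
  have [->|m0] := eqVneq (m z) 0; first by rewrite expr0n/= p0 mul0r.
  have := far_quadratic z ((rho z + 1) / (2 * m z)); rewrite p0 mulr0 addr0.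
  have -> : 2 * ((rho z + 1) / (2 * m z)) * m z = rho z + 1 by field.
  lra.
have pp : 0 < 1 - q z by rewrite lt_neqAle eq_sym p0 subr_ge0.
have := far_quadratic z (m z / (1 - q z)).
have -> : rho z - 2 * (m z / (1 - q z)) * m z + (m z / (1 - q z)) ^+ 2 * (1 - q z)
  = ((1 - q z) * rho z - m z ^+ 2) / (1 - q z) by field.
by rewrite pmulr_lge0 ?invr_gt0// subr_ge0.
Qed.

(** From [v <= z^2 q] and [z^2 (1 - q) <= rho] one gets [v (1 - q) <= q rho]. Together with
    [m^2 <= (1 - q) rho] this gives [v q - m^2 >= v - rho], and [v + rho] is the full second
    moment. *)
Lemma truncated_variance_ge z : 0 < z ->
  mean P (fun w => X w ^+ 2) - 2 * rho z <= v z * q z - m z ^+ 2.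
Proof.
move=> z0; have /andP[q0 q1] := q_bounds z.
have vq : v z <= z ^+ 2 * q z.
  rewrite -meanZ//; apply: mean_le => //; first exact: intgZ.
  move=> w; rewrite /near0; have [zw|_] := ltP; last by rewrite !mulr0.
  rewrite !mulr1 -(@real_normK _ (X w)) ?num_real//.
  by have := normr_ge0 (X w); nra.
have prho : z ^+ 2 * (1 - q z) <= rho z.
  have i1 := intgZ (- z ^+ 2) (inear0 z).
  have -> : z ^+ 2 * (1 - q z) = mean P (fun w => z ^+ 2 + (- z ^+ 2) * near0 z w).
    by rewrite (meanD (intg_cst P (z ^+ 2)) i1) meanZ// mean_cst -/(q z); ring.
  apply: mean_le => //; first exact: intgD (intg_cst P _) i1.
  move=> w; have -> : z ^+ 2 + - z ^+ 2 * near0 z w = z ^+ 2 * far0 z w.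
    by rewrite far0E; ring.
  rewrite /far0; have [zw|_] := leP z; last by rewrite !mulr0.
  rewrite !mulr1 -(@real_normK _ (X w)) ?num_real//.
  by have := normr_ge0 (X w); nra.
have := v_rho z; have := m_sqr_le z.
have : v z * (1 - q z) <= q z * rho z.
  apply: (@le_trans _ _ (z ^+ 2 * q z * (1 - q z))).
    by rewrite ler_wpM2r// subr_ge0.
  by rewrite mulrAC mulrC ler_wpM2l.
lra.
Qed.

Lemma intg_bounded (g : R -> R) : continuous g -> (forall x, `|g x| <= 1) ->
  intg P (fun w => g (X w)).
Proof.
move=> cg g1; apply: (intg_le _ _ (intg_cst P 1)) => [|w]; last by rewrite normr1.
by apply: measurableT_comp => //; exact: continuous_measurable_fun.
Qed.

(* [|x - y| < 2 z] whenever [|x| < z] and [|y| < z]: this bounds the kernel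
   [1 - cos (t * (x - y))] below by a finite sum of products. *)
Lemma symmetrized_charf_ge N (c z : nat -> R) (t : R) :
  (forall j, (j < N)%N -> 0 <= c j) ->
  (forall x, (t * x) ^+ 2 * (\sum_(j < N) c j * (`|x| < 2 * z j)%R%:R) <= 1 - cos (t * x)) ->
  \sum_(j < N) (t ^+ 2 * c j) * (2 * (v (z j) * q (z j) - m (z j) ^+ 2))
  <= 1 - (mean P (fun w => cos (t * X w)) ^+ 2 + mean P (fun w => sin (t * X w)) ^+ 2).
Proof.
move=> c0 step.
have icos : intg P (fun w => cos (t * X w)).
  apply: (@intg_bounded (fun x => cos (t * x))) => [x|x]; last exact: cos_max.
  by apply: continuous_comp; [exact: mulrl_continuous|exact: continuous_cos].
have isin : intg P (fun w => sin (t * X w)).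
  apply: (@intg_bounded (fun x => sin (t * x))) => [x|x]; last exact: sin_max.
  by apply: continuous_comp; [exact: mulrl_continuous|exact: continuous_sin].
rewrite -subr_ge0.
(* This is [(X x - X y)^2] restricted to both truncation events, expanded into products of functions
   of one variable. *)
pose K j (x y : T) : R := (X x ^+ 2 * near0 (z j) x) * near0 (z j) y
  + (-2 * ((X x * near0 (z j) x) * (X y * near0 (z j) y))
    + near0 (z j) x * (X y ^+ 2 * near0 (z j) y)).
have KE j : iterated_mean P (K j) (2 * (v (z j) * q (z j) - m (z j) ^+ 2)).
  have -> : 2 * (v (z j) * q (z j) - m (z j) ^+ 2)
    = v (z j) * q (z j) + (-2 * (m (z j) * m (z j)) + q (z j) * v (z j)) by ring.
  apply: iterated_meanD; first exact: iterated_mean_prod.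
  apply: iterated_meanD; last exact: iterated_mean_prod.
  by apply: iterated_meanZ; exact: iterated_mean_prod.
have SE : iterated_mean P (fun x y => \sum_(j < N) (t ^+ 2 * c j) * K j x y)
    (\sum_(j < N) (t ^+ 2 * c j) * (2 * (v (z j) * q (z j) - m (z j) ^+ 2))).
  apply: (@iterated_mean_sum _ _ _ _ _ (fun j x y => (t ^+ 2 * c j) * K j x y)
    (fun j => (t ^+ 2 * c j) * (2 * (v (z j) * q (z j) - m (z j) ^+ 2)))) => j _.
  exact: iterated_meanZ.
have CE := iterated_meanD (iterated_mean_prod icos icos) (iterated_mean_prod isin isin).
have E1 := iterated_mean_prod (intg_cst P 1) (intg_cst P 1).
(* By the addition formula, the gap between the two sides is the iterated mean of
   [1 - cos (t (X x - X y))] minus the sum of the kernels [K j]; pointwise nonnegativity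
   suffices. *)
have E := iterated_meanD E1 (iterated_meanZ (-1) (iterated_meanD CE SE)).
rewrite !mean_cst in E.
have -> : forall C S U : R, 1 - (C ^+ 2 + S ^+ 2) - U = 1 * 1 + -1 * (C * C + S * S + U).
  by move=> *; ring.
apply: (iterated_mean_ge0 _ E) => x y.
have -> : forall U : R, 1 * 1 + -1 * (cos (t * X x) * cos (t * X y)
      + sin (t * X x) * sin (t * X y) + U) = 1 - cos (t * (X x - X y)) - U.
  by move=> U; rewrite mulrBr cosB; ring.
rewrite subr_ge0; apply: le_trans (step _).
rewrite mulr_sumr; apply: ler_sum => j _.
have -> : K j x y = (X x - X y) ^+ 2 * (near0 (z j) x * near0 (z j) y).
  by rewrite /K; ring.
have -> : forall b : R, (t * (X x - X y)) ^+ 2 * (c j * b)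
    = (t ^+ 2 * c j) * ((X x - X y) ^+ 2 * b) by move=> b; ring.
rewrite ler_wpM2l ?(mulr_ge0 (sqr_ge0 t)) ?c0// ler_wpM2l ?sqr_ge0//.
rewrite /near0; have [xz|] := ltP; last by rewrite mul0r ler0n.
have [yz|] := ltP; last by rewrite mulr0 ler0n.
suff -> : `|X x - X y| < 2 * z j by rewrite mulr1.
by rewrite (le_lt_trans (ler_normB _ _))// mulr_natl mulr2n ltrD.
Qed.

Lemma charf_sqr_le N (c z : nat -> R) (t : R) :
  (forall j, (j < N)%N -> 0 <= c j /\ 0 < z j) ->
  (forall x, (t * x) ^+ 2 * (\sum_(j < N) c j * (`|x| < 2 * z j)%R%:R) <= 1 - cos (t * x)) ->
  mean P (fun w => cos (t * X w)) ^+ 2 + mean P (fun w => sin (t * X w)) ^+ 2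
  <= 1 - 2 * t ^+ 2 * \sum_(j < N) c j * (mean P (fun w => X w ^+ 2)
       - 2 * mean P (fun w => X w ^+ 2 * (z j <= `|X w|)%R%:R)).
Proof.
move=> cz step; rewrite lerBrDr -lerBrDl.
apply: le_trans (symmetrized_charf_ge _ step); last by move=> j /cz[].
rewrite mulr_sumr; apply: ler_sum => j _; have [c0 z0] := cz j (ltn_ord j).
have -> : forall b : R, 2 * t ^+ 2 * (c j * b) = t ^+ 2 * c j * (2 * b).
  by move=> b; ring.
by rewrite ler_wpM2l ?(mulr_ge0 (sqr_ge0 t))// ler_wpM2l// truncated_variance_ge.
Qed.

End OneVariable.
(** * Layer-cake approximation and the bound on [fbar] *)

Section StepApproximation.
Context {R : realType}.

(* Geometric grid [v j = u q^j]; the jump [c j] is the increment of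
   [A - B y ^+ 2] between [v (j - 1)] and [v j], the jump at [u] being [A - B u ^+ 2]. *)
Lemma step_below_parabola (A B u q : R) (c v : nat -> R) :
  0 <= B -> B * u ^+ 2 <= A -> 0 < u -> 0 < q < 1 ->
  (forall j, v j = u * q ^+ j) -> c 0%N = A - B * u ^+ 2 ->
  (forall j, c j.+1 = B * (v j ^+ 2 - v j.+1 ^+ 2)) ->
  forall M y, 0 <= y < u ->
  \sum_(j < M.+1) c j * (y < v j)%R%:R <= A - B * Num.max y (v M) ^+ 2.
Proof.
move=> B0 BA u0 /andP[q0 q1] vE c0 cS M y /andP[y0 yu].
have v0 j : 0 < v j by rewrite vE mulr_gt0// exprn_gt0.
have vdec j : v j.+1 <= v j.
  by rewrite !vE exprS ler_pM2l// ler_piMl ?(ltW q1)// exprn_ge0// ltW.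
(* If [y < v M.+1], the maximum moves from [v M] to [v M.+1] and the bound grows by exactly the new
   jump. Otherwise the sum is unchanged and the maximum does not grow. *)
elim: M => [|M IH].
  by rewrite big_ord1 c0 vE expr0 mulr1 yu mulr1 max_r// ltW.
rewrite big_ord_recr/= cS; have [yv|vy] := ltP y (v M.+1).
  rewrite mulr1 max_r in IH *; last by rewrite (le_trans (ltW yv)).
  lra.
rewrite mulr0 addr0 (le_trans IH)// lerD2l lerN2 ler_wpM2l//.
by rewrite ler_pXn2r ?nnegrE ?le_max ?y0// lexx.
Qed.

(** In the limit of a fine grid, the jump at [u] contributes [(A - B u^2) / u] to
    [\sum_j c_j / v_j], and the jumps of density [2 B y] below [u], divided by [y], contribute
    [2 B u]; the total is [(A + B u^2) / u]. *)
Lemma step_approximation (A B u e : R) :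
  0 <= B -> B * u ^+ 2 <= A -> 0 < u -> 0 < e ->
  exists (N : nat) (c v : nat -> R), [/\
    forall j, (j < N)%N -> 0 <= c j /\ 0 < v j <= u,
    forall y, 0 <= y < u -> \sum_(j < N) c j * (y < v j)%R%:R <= A - B * y ^+ 2,
    A - e <= \sum_(j < N) c j &
    \sum_(j < N) c j / v j <= (A + B * u ^+ 2) / u + e].
Proof.
move=> B0 BA u0 e0.
have Bu0 : 0 <= B * u by rewrite mulr_ge0// ltW.
(* With [q^-1 = 1 + n], the factor [B u (q^-1 + 1)] exceeds [2 B u] by at most [e]. The [+ 1] keeps
   the denominator positive when [B = 0]. *)
pose n := e / (B * u + 1); have n0 : 0 < n by rewrite divr_gt0// ltr_wpDl.
pose q : R := (1 + n)^-1.
have q0 : 0 < q by rewrite invr_gt0; lra.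
have q1 : q < 1 by rewrite invf_lt1; lra.
(* This choice bounds the part [B (v M)^2] missing from the telescoping sum of the jumps. *)
have [M qM] : exists M, q ^+ M < e / (B * u ^+ 2 + 1).
  have /cvgr_lt := @cvg_expr R q ltac:(by rewrite gtr0_norm).
  move=> /(_ (e / (B * u ^+ 2 + 1))) H.
  have /H[M _ /(_ M (leqnn M))] : 0 < e / (B * u ^+ 2 + 1).
    by rewrite divr_gt0// ltr_wpDl// (mulr_ge0 B0)// sqr_ge0.
  by exists M.
pose v j : R := u * q ^+ j.
pose c j : R := if j is i.+1 then B * (v i ^+ 2 - v i.+1 ^+ 2) else A - B * u ^+ 2.
have v0 j : 0 < v j by rewrite mulr_gt0// exprn_gt0.
have qX j : q ^+ j <= 1 by rewrite exprn_ile1// ltW.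
have vdec j : v j.+1 <= v j.
  by rewrite /v exprS ler_pM2l// ler_piMl ?(ltW q1)// exprn_ge0// ltW.
exists M.+1, c, v; split.
- move=> j _; rewrite v0/=; split; last by rewrite /v ler_piMr// ltW.
  case: j => [|j] /=; first by rewrite subr_ge0.
  by rewrite mulr_ge0// subr_ge0 ler_pXn2r ?nnegrE ?(ltW (v0 _)).
- move=> y /andP[y0 yu].
  apply: le_trans (@step_below_parabola A B u q c v _ _ _ _ _ _ _ M y _) _ => //.
  + by rewrite q0.
  + by rewrite y0.
  rewrite lerD2l lerN2 ler_wpM2l// ler_pXn2r ?nnegrE ?le_max ?y0 ?lexx//.
- have -> : \sum_(j < M.+1) c j = A - B * v M ^+ 2.
    elim: (M) => [|i IH]; first by rewrite big_ord1/= /v expr0 mulr1.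
    by rewrite big_ord_recr IH /=; ring.
  rewrite lerD2l lerN2 /v exprMn mulrA.
  have qM0 : 0 <= q ^+ M by rewrite exprn_ge0// ltW.
  have : (B * u ^+ 2 + 1) * q ^+ M <= e.
    rewrite mulrC -ler_pdivlMr ?(ltW qM)// ltr_wpDl//.
    by rewrite (mulr_ge0 B0)// sqr_ge0.
  have : (q ^+ M) ^+ 2 <= q ^+ M by rewrite expr2 ler_piMl.
  have : 0 <= B * u ^+ 2 by rewrite mulr_ge0// sqr_ge0.
  nra.
have q0' : q != 0 by rewrite lt0r_neq0.
have u0' : u != 0 by rewrite lt0r_neq0.
have -> : \sum_(j < M.+1) c j / v j
    = (A - B * u ^+ 2) / u + B * u * (q^-1 + 1) * (1 - q ^+ M).
  elim: (M) => [|i IH]; first by rewrite big_ord1/= /v expr0 mulr1 subrr mulr0 addr0.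
  rewrite big_ord_recr IH /= /v !exprS; field.
  by rewrite ?u0' ?q0' ?expf_neq0.
have -> : (A + B * u ^+ 2) / u + e = (A - B * u ^+ 2) / u + (2 * (B * u) + e).
  by field.
rewrite lerD2l (@le_trans _ _ (B * u * (q^-1 + 1)))//.
  have qM0 : 0 <= q ^+ M by rewrite exprn_ge0// ltW.
  have qV0 : 0 <= q^-1 by rewrite invr_ge0 ltW.
  by rewrite ler_piMr ?(mulr_ge0 Bu0)//; lra.
have : (B * u + 1) * n = e by rewrite /n mulrC divfK// lt0r_neq0// ltr_wpDl.
rewrite /q invrK; nra.
Qed.

End StepApproximation.

(** * Suprema in the exponent *)

Section ExpeRSup.
Context {R : realType}.

(** For [y > 0], logarithms turn the bounds for the members of [S] into the common upper bound
    [- ln y / s], so the supremum need not be attained. *)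
Lemma le_expeR_sup (S : set (\bar R)) (y s : R) : 0 <= y -> 0 < s ->
  (forall x, S x -> exists2 r, x = r%:E & y <= expR (- r * s)) ->
  (y%:E <= expeR (- ereal_sup S * s%:E))%E.
Proof.
move=> y0 s0 Sy; move: y0; rewrite le_eqVlt => /predU1P[<-|y0].
  exact: expeR_ge0.
have supy : (ereal_sup S <= (- ln y / s)%:E)%E.
  apply: ub_ereal_sup => _ /Sy[r -> yr]; rewrite lee_fin ler_pdivlMr// lerNr.
  by rewrite -mulNr -[leRHS]expRK ler_ln// posrE// expR_gt0.
rewrite -{1}(lnK y0) -[(expR _)%:E]/(expeR (ln y)%:E) lee_expeR.
have -> : (ln y)%:E = (- (- ln y / s)%:E * s%:E)%E.
  by rewrite -EFinN -EFinM mulNr divfK ?opprK// lt0r_neq0.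
by rewrite lee_wpmul2r ?lee_fin ?(ltW s0)// leeN2.
Qed.

End ExpeRSup.

(** * Bounds on the product of the characteristic functions *)

Section Sum.
Context {d : measure_display} {T : measurableType d} {R : realType}.
Variables (P : probability T R) (n : nat) (X : 'I_n -> {RV P >-> R}).
Hypothesis X1 : forall k, intg P (X k).
Hypothesis X2 : forall k, intg P (fun w => X k w ^+ 2).
Hypothesis EX0 : forall k, expectation P (X k) = 0%E.
Hypothesis var1 : \sum_(k < n) sigma2 P (fun k => X k) k = 1.

Local Notation fb t := (Normc.normc (fbar P (fun k => X k) t)).
Local Notation L_ z := (Ln P (fun k => X k) z).

Lemma normc_prod (I : Type) (r : seq I) (F : I -> complex.complex R) :
  Normc.normc (\prod_(i <- r) F i) = \prod_(i <- r) Normc.normc (F i).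
Proof.
exact: (big_morph _ (@Normc.normcM R) (@Normc.normc1 R)).
Qed.

(** Each factor satisfies [|f_k|^2 <= 1 - 2 D k <= exp (- 2 D k)]. In the product the exponents add
    up, and the variances sum to [1]. *)
Lemma fbar_le_exp N (c z : nat -> R) (t : R) :
  (forall j, (j < N)%N -> 0 <= c j /\ 0 < z j) ->
  (forall x, (t * x) ^+ 2 * (\sum_(j < N) c j * (`|x| < 2 * z j)%R%:R)
     <= 1 - cos (t * x)) ->
  fb t <= expR (- t ^+ 2 * \sum_(j < N) c j * (1 - 2 * L_ (z j))).
Proof.
move=> cz step; rewrite normc_prod.
pose D k := t ^+ 2 * \sum_(j < N) c j * (sigma2 P (fun k => X k) k
       - 2 * sigma2z P (fun k => X k) k (z j)).
have fk k : Normc.normc (charf P (fun k => X k) k t) <= expR (- D k).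
  have E0 : mean P (X k) = 0 by rewrite /mean EX0.
  have le := charf_sqr_le (X1 k) (X2 k) E0 cz step.
  rewrite /charf /Normc.normc -[leRHS]ger0_norm ?expR_ge0// -sqrtr_sqr ler_wsqrtr//.
  apply: (le_trans le); rewrite -expRM_natl; apply: le_trans (expR_ge1Dx _).
  by rewrite lerD2l /D le_eqVlt; apply/orP; left; apply/eqP; ring.
apply: (@le_trans _ _ (\prod_(k < n) expR (- D k))).
  by apply: ler_prod => k _; rewrite fk andbT; case: (charf _ _ _ _) => a b; exact: sqrtr_ge0.
rewrite -(big_morph _ (@expRD R) (@expR0 R)) ler_expR sumrN mulNr lerN2.
rewrite /D -mulr_sumr exchange_big/= ler_wpM2l ?sqr_ge0//.
apply: ler_sum => j _; rewrite -mulr_sumr sumrB var1 -mulr_sumr; exact: lexx.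
Qed.

Lemma fbar_le1 t : fb t <= 1.
Proof.
apply: le_trans (@fbar_le_exp 0 (fun=> 0) (fun=> 0) t _ _) _ => //.
- by move=> x; rewrite big_ord0 mulr0 subr_ge0 cos_le1.
- by rewrite big_ord0 mulr0 expR0.
Qed.

Variables (eps : \bar R) (L : R).
Hypothesis eps0 : (0 < eps)%E.
Hypothesis L0 : 0 < L.
Hypothesis HL : forall z, 0 < z -> (z%:E <= eps)%E -> z * L_ z <= L ^+ 3.

(** A step at [v j] in the variable [|t x|] corresponds to the truncation level [z = v j / (2 |t|)].
    There [z L_n(z) <= L^3] reads [2 L_n(z) <= 4 tau / v j], and summation produces the two sums
    controlled by [step_approximation]. *)
Lemma fbar_le_kernel t u th : t != 0 -> 0 < th < 2 * pi ->
  0 < u <= Num.sqrt (afun th / bfun th) ->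
  (forall z, 0 < z -> 2 * `|t| * z <= u -> (z%:E <= eps)%E) ->
  fb t <= expR (- (afun th - 4 * (L ^+ 3 * `|t|) / u
                    * (afun th + bfun th * u ^+ 2)) * t ^+ 2).
Proof.
move=> t0 thpi /andP[u0 usq] ueps.
have a0 := afun_gt0 thpi; have b0 := bfun_gt0 thpi; have t0' : 0 < `|t| by rewrite normr_gt0.
set tau := L ^+ 3 * `|t|.
have tau0 : 0 < tau by rewrite mulr_gt0// exprn_gt0.
have t2 : 0 < t ^+ 2 by rewrite exprn_even_gt0.
have bua : bfun th * u ^+ 2 <= afun th.
  rewrite mulrC -ler_pdivlMr//.
  rewrite -[leRHS]sqr_sqrtr; last by rewrite divr_ge0// ltW.
  by rewrite ler_pXn2r ?nnegrE ?sqrtr_ge0// ltW.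
set K := afun th - _.
have : 0 <= fb t by case: (fbar _ _ _) => x y; exact: sqrtr_ge0.
rewrite le_eqVlt => /predU1P[<-|f0]; first exact: expR_ge0.
rewrite -[leLHS](lnK f0) ler_expR; apply/ler_addgt0Pr => e e0.
(* With this precision [d], the losses [d] in the sum of the jumps and [4 tau d] in the weighted sum
   amount to exactly [e] after multiplication by [t^2]. *)
have d0 : 0 < e / (t ^+ 2 * (1 + 4 * tau)).
  by rewrite divr_gt0// mulr_gt0// ltr_pwDl// mulr_ge0// ltW.
have [N [c [v [cv below sumc sumcv]]]] := step_approximation (ltW b0) bua u0 d0.
have v2 j : 2 * (v j / (2 * `|t|)) = v j / `|t| by field; rewrite lt0r_neq0.
have fle : fb t <= expR (- t ^+ 2 * \sum_(j < N) c j *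
    (1 - 2 * L_ (v j / (2 * `|t|)))).
  apply: (@fbar_le_exp N c (fun j => v j / (2 * `|t|)) t) => [j /cv[? /andP[? _]]|x].
    by split=> //; rewrite divr_gt0// mulr_gt0.
  rewrite /= -[cos (t * x)]cos_norm normrM.
  have -> : (t * x) ^+ 2 = (`|t| * `|x|) ^+ 2 by rewrite -normrM real_normK// num_real.
  set y := `|t| * `|x|.
  have -> : \sum_(j < N) c j * (`|x| < 2 * (v j / (2 * `|t|)))%R%:R
     = \sum_(j < N) c j * (y < v j)%R%:R.
    by apply: eq_bigr => j _; rewrite v2 ltr_pdivlMr// [`|x| * _]mulrC.
  have y0 : 0 <= y by rewrite mulr_ge0.
  (* Below [u] the tangent bound applies; from [u] on every step is zero, because [v j <= u]. *)
  have [yu|uy] := ltP y u.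
    have ypi : y < 2 * pi.
      by rewrite (lt_le_trans yu)// (le_trans usq)// sqrt_afun_div_bfun_le.
    have := @cos_tangent R th y thpi; rewrite y0 ypi => /(_ isT); apply: le_trans.
    by rewrite ler_wpM2l ?sqr_ge0// below// y0.
  rewrite big1 ?mulr0 ?subr_ge0 ?cos_le1// => j _.
  have [_ /andP[_ vu]] := cv j (ltn_ord j).
  by rewrite ltNge (le_trans vu)// mulr0.
have {fle} : ln (fb t) <= - t ^+ 2 * \sum_(j < N) c j *
    (1 - 2 * L_ (v j / (2 * `|t|))) by rewrite -[leRHS]expRK ler_ln// posrE expR_gt0.
move=> /le_trans; apply.
have key : \sum_(j < N) c j - 4 * tau * \sum_(j < N) c j / v j
    <= \sum_(j < N) c j * (1 - 2 * L_ (v j / (2 * `|t|))).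
  rewrite mulr_sumr -sumrB; apply: ler_sum => j _.
  have [c0 /andP[v0 vu]] := cv j (ltn_ord j).
  have -> : c j - 4 * tau * (c j / v j) = c j * (1 - 4 * tau / v j) by ring.
  rewrite ler_wpM2l// lerD2l lerN2 ler_pdivlMr//.
  have zj : 0 < v j / (2 * `|t|) by rewrite divr_gt0// mulr_gt0.
  have := HL zj (ueps _ zj _); rewrite mulrC divfK ?vu ?mulf_neq0 ?lt0r_neq0//.
  move=> /(_ isT); set l := L_ _ => h.
  have -> : 2 * l * v j = 4 * (v j / (2 * `|t|) * l) * `|t| by field; rewrite lt0r_neq0.
  by rewrite /tau -mulrA ler_wpM2l// ler_wpM2r.
have : K - (1 + 4 * tau) * (e / (t ^+ 2 * (1 + 4 * tau)))
    <= \sum_(j < N) c j - 4 * tau * \sum_(j < N) c j / v j.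
  have := ler_wpM2l (ltac:(lra) : 0 <= 4 * tau) sumcv.
  rewrite /K; have -> : 4 * tau / u * (afun th + bfun th * u ^+ 2)
    = 4 * tau * ((afun th + bfun th * u ^+ 2) / u) by ring.
  lra.
have -> : (1 + 4 * tau) * (e / (t ^+ 2 * (1 + 4 * tau))) = e / t ^+ 2.
  by field; rewrite t0 lt0r_neq0// ltr_pwDl// mulr_ge0// ltW.
move=> /le_trans/(_ key) /(ler_wpM2l (ltW t2)).
rewrite mulrBr [t ^+ 2 * (e / _)]mulrC divfK ?(lt0r_neq0 t2)//; lra.
Qed.

Lemma fbar_le_k2 t : ((fb t)%:E <=
  expeR (- k2 (L ^+ 3 * `|t|) ((2 * `|t|)%:E * eps) * (t ^+ 2)%:E))%E.
Proof.
have [->|t0] := eqVneq t 0.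
  by rewrite expr0n/= mule0 expeR0 lee_fin fbar_le1.
have t0' : 0 < 2 * `|t| by rewrite mulr_gt0// normr_gt0.
apply: le_expeR_sup.
- by case: (fbar _ _ _) => x y; exact: sqrtr_ge0.
- by rewrite exprn_even_gt0.
move=> _ [th thpi <-].
have sq0 : 0 < Num.sqrt (afun th / bfun th).
  by rewrite sqrtr_gt0 divr_gt0 ?afun_gt0 ?bfun_gt0.
set u := umin _ _.
(* Positivity of [u] selects the finite first branch of [k3]. *)
have [u0 usq] : 0 < u /\ u <= Num.sqrt (afun th / bfun th).
  rewrite /u; case: (eps) eps0 => [r| |]// r0.
    by rewrite -EFinM /= lt_min sq0 ge_min lexx orbT andbT mulr_gt0.
  by rewrite gt0_muley ?lte_fin//=.
rewrite /k3 u0; eexists; first by [].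
apply: fbar_le_kernel => //; first by rewrite u0.
move=> z z0; rewrite /u; case: (eps) eps0 => [r| |]// r0; last by rewrite leey.
rewrite -EFinM /= le_min => /andP[+ _].
by rewrite ler_pM2l// lee_fin.
Qed.

Lemma fbar_le_k1 M tau t : L <= M -> tau1 M eps <= tau -> `|t| <= tau / L ^+ 3 ->
  ((fb t)%:E <= expeR (- k1 tau * (t ^+ 2)%:E))%E.
Proof.
move=> LM tau1le tle.
have [->|t0] := eqVneq t 0.
  by rewrite expr0n/= mule0 expeR0 lee_fin fbar_le1.
have t0' : 0 < `|t| by rewrite normr_gt0.
have L3 : 0 < L ^+ 3 by rewrite exprn_gt0.
have LM3 : L ^+ 3 <= M ^+ 3 by rewrite ler_pXn2r// nnegrE ltW// (lt_le_trans L0).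
have tauL : L ^+ 3 * `|t| <= tau by rewrite mulrC -ler_pdivlMr.
apply: le_expeR_sup.
- by case: (fbar _ _ _) => x y; exact: sqrtr_ge0.
- by rewrite exprn_even_gt0.
move=> _ [th thpi <-]; eexists; first by [].
(* At [th = 2 * pi] both functions vanish and the claim is [|fbar| <= 1]. *)
move: thpi => /andP[th0]; rewrite le_eqVlt => /predU1P[->|thpi].
  by rewrite afun2pi mul0r sqrtr0 mulr0 subrr oppr0 mul0r expR0 fbar_le1.
have {}thpi : 0 < th < 2 * pi by rewrite th0.
have a0 := afun_gt0 thpi; have b0 := bfun_gt0 thpi.
have ab0 : 0 < afun th / bfun th by rewrite divr_gt0.
set s := Num.sqrt (afun th / bfun th).
have s0 : 0 < s by rewrite sqrtr_gt0.
have s2 : bfun th * s ^+ 2 = afun th.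
  by rewrite sqr_sqrtr ?(ltW ab0)// mulrC divfK// lt0r_neq0.
have sab : Num.sqrt (afun th * bfun th) = afun th / s.
  apply/eqP; rewrite -(@eqrXn2 _ 2) ?sqrtr_ge0 ?divr_ge0 ?(ltW a0) ?(ltW s0)//.
  rewrite sqr_sqrtr ?mulr_ge0 ?(ltW a0) ?(ltW b0)// expr_div_n -{1 2}s2; apply/eqP.
  by field; rewrite lt0r_neq0.
have red u : 0 < u <= s ->
    (forall z, 0 < z -> 2 * `|t| * z <= u -> (z%:E <= eps)%E) ->
    L ^+ 3 * `|t| / u * (afun th + bfun th * u ^+ 2) <= 2 * tau * (afun th / s) ->
    fb t <= expR (- (afun th - 8 * tau * Num.sqrt (afun th * bfun th)) * t ^+ 2).
  move=> us ueps le; apply: le_trans (fbar_le_kernel t0 thpi us ueps) _.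
  rewrite ler_expR sab ler_wpM2r ?sqr_ge0//; lra.
have large : (forall z, 0 < z -> 2 * `|t| * z <= s -> (z%:E <= eps)%E) ->
    fb t <= expR (- (afun th - 8 * tau * Num.sqrt (afun th * bfun th)) * t ^+ 2).
  move=> seps; apply: (red s) => //; first by rewrite s0 lexx.
  rewrite s2.
  have -> : L ^+ 3 * `|t| / s * (afun th + afun th)
    = L ^+ 3 * `|t| * (2 * (afun th / s)) by ring.
  have -> : 2 * tau * (afun th / s) = tau * (2 * (afun th / s)) by ring.
  by rewrite ler_wpM2r// mulr_ge0// divr_ge0 ?(ltW a0) ?(ltW s0).
have [[r epsE]|epsy] : (exists r, eps = r%:E) \/ eps = +oo%E.
- by case: (eps) eps0 => [r| |]// _; [left; exists r|right].
- have r0 : 0 < r by move: eps0; rewrite epsE.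
  (* If [s <= 2 r |t|], take [u = s], where [a + b s^2 = 2 a] and [a / s = sqrt (a b)]. Otherwise
     take [u = 2 r |t|]: then [a + b u^2 <= 2 a], and [L^3 |t| / u = L^3 / (2 r) <= tau / (2 pi) <=
     tau / s]. *)
  have [srt|rts] := leP s (2 * `|t| * r).
    apply: large => z z0 zs; rewrite epsE lee_fin.
    by rewrite -(@ler_pM2l _ (2 * `|t|)) ?mulr_gt0//; exact: le_trans srt.
  apply: (red (2 * `|t| * r)).
  + by rewrite !mulr_gt0//= ltW.
  + by move=> z z0; rewrite epsE ler_pM2l ?mulr_gt0// lee_fin.
  have pM : pi * L ^+ 3 <= tau * r.
    move: tau1le; rewrite epsE /= ler_pdivrMr//; apply: le_trans.
    by rewrite ler_wpM2l// pi_ge0.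
  have spi : s <= 2 * pi by exact: sqrt_afun_div_bfun_le.
  have bua : bfun th * (2 * `|t| * r) ^+ 2 <= afun th.
    rewrite -[leRHS]s2 ler_wpM2l ?(ltW b0)// ler_pXn2r ?nnegrE ?(ltW s0) ?(ltW rts)//.
    by rewrite !mulr_ge0// ltW.
  have -> : L ^+ 3 * `|t| / (2 * `|t| * r) = L ^+ 3 / (2 * r).
    by field; rewrite !lt0r_neq0.
  apply: (@le_trans _ _ (L ^+ 3 / (2 * r) * (2 * afun th))).
    have c0 : 0 <= L ^+ 3 / (2 * r) by rewrite divr_ge0 ?(ltW L3)//; lra.
    by rewrite ler_wpM2l//; lra.
  have -> : L ^+ 3 / (2 * r) * (2 * afun th) = afun th * (L ^+ 3 / r).
    by field; rewrite lt0r_neq0.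
  have -> : 2 * tau * (afun th / s) = afun th * (2 * tau / s) by ring.
  rewrite ler_wpM2l ?(ltW a0)// ler_pdivlMr// mulrAC ler_pdivrMr//.
  apply: (@le_trans _ _ (L ^+ 3 * (2 * pi))); first by rewrite ler_wpM2l// ltW.
  lra.
- by apply: large => z _ _; rewrite epsy leey.
Qed.

Lemma conclusions_of_bound : conclusions P (fun k => X k) eps L.
Proof.
split; first exact: fbar_le_k2.
split; first by move=> M LM tau tauM t; exact: fbar_le_k1 LM tauM.
split=> [tau|M LM]; first exact: k1_gt0P.
exact: tau1_nonempty (lt_le_trans L0 LM) eps0.
Qed.

End Sum.
Theorem theorem4 (d : measure_display) (T : measurableType d) (R : realType)
  (P : probability T R) (n : nat) (X : 'I_n -> {RV P >-> R})
  (Hindep : mutually_independent P (fun k => X k))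
  (Hint1 : forall k, P.-integrable setT (EFin \o X k))
  (Hmean : forall k, expectation P (X k) = 0%E)
  (Hint2 : forall k, P.-integrable setT (EFin \o (fun w => X k w ^+ 2)))
  (Hnorm : \sum_(k < n) sigma2 P (fun k => X k) k = 1)
  (gamma : R) (Hgamma : 0 < gamma) (L : R) (HL : 0 < L) :
  (* eps in (0, +oo], L^3 = L_{E,n}^3(eps, gamma) *)
  (forall eps : \bar R, (0 < eps)%E ->
     (L ^+ 3)%:E = LE3 P (fun k => X k) eps gamma ->
     conclusions P (fun k => X k) eps L)
  /\
  (* eps in (0, +oo), L^3 = L_{R,n}^3(eps, gamma) *)
  (forall eps : R, 0 < eps ->
     (L ^+ 3)%:E = LR3 P (fun k => X k) eps gamma ->
     conclusions P (fun k => X k) eps%:E L)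
  /\
  (* (iii): eps in (0, +oo], L^3 = sup_{0<z<=eps} z L_n(z) *)
  (forall eps : \bar R, (0 < eps)%E ->
     (L ^+ 3)%:E = Lsup3 P (fun k => X k) eps ->
     conclusions P (fun k => X k) eps L).
Proof.
(* All three definitions of [L] yield this bound on [z * Ln z], the terms in [Mn] being
   nonnegative. *)
have main (eps : \bar R) : (0 < eps)%E ->
    (forall z, 0 < z -> (z%:E <= eps)%E -> z * Ln P (fun k => X k) z <= L ^+ 3) ->
    conclusions P (fun k => X k) eps L.
  by move=> eps0 H; apply: conclusions_of_bound.
split=> [eps eps0 LE|]; last split=> [eps eps0 LE|eps eps0 LE].
- apply: main => // z z0 zeps; rewrite -lee_fin LE.
  apply: le_trans (ereal_sup_ubound _); last by exists z.
  by rewrite lee_fin lerDr mulr_ge0// ltW.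
- apply: main; first by rewrite lte_fin.
  move=> z z0 zeps; rewrite -lee_fin LE /LR3 -[leLHS]add0e.
  apply: leeD; first by rewrite lee_fin mulr_ge0// ltW.
  by apply: ereal_sup_ubound; exists z => //=; rewrite z0 -lee_fin.
- apply: main => // z z0 zeps; rewrite -lee_fin LE.
  by apply: ereal_sup_ubound; exists z.
Qed.
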